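(* Let $N\geq 2$ and let $p,q>N$ be integers with $\gcd(N,p)=\gcd(N,q)=1$. Let $K=K(N,p,q)\subset\mathbb{S}^3$ be the associated simple minimal knot, and let $d=\gcd(p,q)$. If $d\neq 1$, then $K$ is a periodic knot.
   Context: Simple minimal knots: let $\overline{\mathbb{D}}$ be the closed unit disk in $\mathbb{C}$ and $\mathbb{S}^3$ the unit sphere of $\mathbb{C}^2$. Consider $$\phi_{N,p,q}(z)=\bigl(z^N,\ a(z^q-\bar z^q)+b(e^{i\delta}z^p+e^{-i\delta}\bar z^p)\bigr),\qquad z\in\overline{\mathbb{D}},$$ where $a,b$ are complex numbers and $\delta$ is a real number (the phase; the basic choice is $\delta=0$), chosen so that $\phi_{N,p,q}$ is injective and so that for every $\theta\in\mathbb{R}$ there is exactly one $r(\theta)\in(0,1]$ with $\phi_{N,p,q}(r(\theta)e^{i\theta})\in\mathbb{S}^3$, the function $r$ being continuous. Then $K(N,p,q)=\mathbb{S}^3\cap\phi_{N,p,q}(\overline{\mathbb{D}})=\{\phi_{N,p,q}(r(\theta)e^{i\theta}) : e^{i\theta}\in\mathbb{S}^1\}$, which is a knot in $\mathbb{S}^3$. A knot $K\subset\mathbb{S}^3$ is called periodic if there is an orientation-preserving homeomorphism $\Psi$ of $\mathbb{S}^3$ of finite order $n>1$ such that $\Psi(K)=K$ and the fixed point set of $\Psi$ is homeomorphic to $\mathbb{S}^1$ and disjoint from $K$. *)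

(* Defs.v *)
(* MathComp / MathComp-Analysis *)
From HB Require Import structures.
From mathcomp Require Import all_boot all_order all_algebra.
From mathcomp Require Import all_classical all_reals all_analysis.
From mathcomp.real_closed Require Import complex.
From mathcomp.multinomials Require Import freeg.

Set Implicit Arguments.
Unset Strict Implicit.
Unset Printing Implicit Defensive.

Import Order.TTheory GRing.Theory Num.Theory.
Import numFieldNormedType.Exports.

Local Open Scope classical_set_scope.
Local Open Scope ring_scope.
Local Open Scope complex_scope.

Definition homeomorphism (X Y : topologicalType) (f : X -> Y) : Prop :=
  continuous f /\
  exists g : Y -> X, [/\ continuous g, cancel f g & cancel g f].

Definition homeomorphic (X Y : topologicalType) : Prop :=
  exists f : X -> Y, homeomorphism f.

Definition simplex (R : realType) (n : nat) : set 'rV[R]_n.+1 :=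
  [set x | (forall i, 0 <= x ord0 i) /\ \sum_i x ord0 i = 1].
Arguments simplex : clear implicits.

(* Inserts a zero coordinate at position [i]: this is the affine map onto the
   [i]-th face, sending vertices to vertices in increasing order. *)
Definition face_fun (R : realType) (n : nat) (i : 'I_n.+2) (x : 'rV[R]_n.+1) :
    'rV[R]_n.+2 :=
  \row_j (if unlift i j is Some k then x ord0 k else 0).

Lemma face_in (R : realType) (n : nat) (i : 'I_n.+2) (x : simplex R n) :
  face_fun i (set_val x) \in simplex R n.+1.
Proof.
have [x0 x1] := set_valP x; apply/mem_set; split=> [j|].
  by rewrite mxE; case: unliftP.
rewrite (bigD1_ord i) //= mxE unlift_none add0r -[RHS]x1.
by apply: eq_bigr => j _; rewrite mxE liftK.
Qed.

Definition face (R : realType) (n : nat) (i : 'I_n.+2) (x : simplex R n) :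
    simplex R n.+1 :=
  exist _ (face_fun i (set_val x)) (face_in i x).

Lemma face_continuous (R : realType) (n : nat) (i : 'I_n.+2) :
  continuous (@face R n i).
Proof.
apply: continuous_comp_initial => x A [P xP PA].
have xP' k j : \forall y \near x, P k j (face_fun i (set_val y) k j).
  have coordc : continuous (fun y : simplex R n =>
      face_fun i (set_val y) k j).
    rewrite /face_fun; case Ej : (unlift i j) => [l|]; last first.
      rewrite (_ : (fun _ => _) = cst 0); first exact: cst_continuous.
      by apply/funext => y; rewrite mxE Ej.
    rewrite (_ : (fun _ => _) = (fun M : 'rV[R]_n.+1 => M ord0 l) \o set_val).
      move=> y; apply: continuous_comp; first exact: initial_continuous.
      exact: coord_continuous.
    by apply/funext => y; rewrite mxE Ej.
  exact: (coordc x _ (xP k j)).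
have : \forall y \near x, forall k j, P k j (face_fun i (set_val y) k j).
  apply: (@filter_forall _ _ (fun k y => forall j,
    P k j (face_fun i (set_val y) k j)) (nbhs x)) => k.
  exact: (@filter_forall _ _ (fun j y =>
    P k j (face_fun i (set_val y) k j)) (nbhs x)) (xP' k).
by apply: filterS => y Py; apply: PA => k j; exact: Py.
Qed.

HB.instance Definition _ (R : realType) (n : nat) (i : 'I_n.+2) :=
  @isContinuous.Build (simplex R n) (simplex R n.+1) (@face R n i)
    (@face_continuous R n i).

Notation singular_simplex R n X :=
  (continuousType (set_type (simplex R n)) X).
Notation singular_chain R n X := {freeg (singular_simplex R n X) / int}.

Definition boundary (R : realType) (n : nat) (X : topologicalType) :
    singular_chain R n.+1 X -> singular_chain R n X :=
  fglift (fun s : singular_simplex R n.+1 X =>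
    \sum_(i < n.+2) (-1) ^+ i *:
      (<< (s \o @face R n i : singular_simplex R n X) >>
        : singular_chain R n X)).

Definition chain_map (R : realType) (n : nat) (X Y : topologicalType)
    (f : continuousType X Y) : singular_chain R n X -> singular_chain R n Y :=
  fglift (fun s : singular_simplex R n X =>
    << (f \o s : singular_simplex R n Y) >> : singular_chain R n Y).

(* [f] induces the identity on H_(n.+1)(X; Z), the singular homology in positive
   degree [n.+1]: every cycle is homologous to its image by [f]. *)
Definition homology_identity (R : realType) (n : nat) (X : topologicalType)
    (f : continuousType X X) : Prop :=
  forall c : singular_chain R n.+1 X, boundary c = 0 ->
    exists e : singular_chain R n.+2 X, boundary e = chain_map f c - c.
Arguments homology_identity R n {X} f.

(* [R[i]^o] is [R[i]] seen as a normed module over itself, hence as a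
   topological space, with the topology of the complex modulus. *)
Definition sphere1 (R : realType) : set R[i]^o := [set z | `|z : R[i]| = 1].
Arguments sphere1 : clear implicits.

Definition sphere3 (R : realType) : set (R[i]^o * R[i]^o) :=
  [set w | `|w.1 : R[i]| ^+ 2 + `|w.2 : R[i]| ^+ 2 = 1].
Arguments sphere3 : clear implicits.

Definition closed_disk (R : realType) : set R[i] := [set z | `|z| <= 1].
Arguments closed_disk : clear implicits.

(* Subsets [K] of the sphere are sets over the subtype [set_type (sphere3 R)],
   and [set_type K] carries the subspace topology. *)
Definition is_knot (R : realType) (K : set (sphere3 R)) : Prop :=
  homeomorphic (set_type (sphere1 R)) (set_type K).

(* A homeomorphism of the 3-sphere preserves the orientation iff it fixes the
   fundamental class, a generator of H_3(S^3; Z), i.e. iff it acts as the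
   identity on H_3(S^3; Z). *)
Definition orientation_preserving (R : realType)
    (f : continuousType (sphere3 R) (sphere3 R)) : Prop :=
  homology_identity R 2 f.

Definition fixed_set (T : Type) (f : T -> T) : set T := [set x | f x = x].

Definition has_order (T : Type) (f : T -> T) (n : nat) : Prop :=
  [/\ (0 < n)%N, iter n f =1 id &
      forall m : nat, (0 < m < n)%N -> ~ iter m f =1 id].

Definition periodic_knot (R : realType) (K : set (sphere3 R)) : Prop :=
  is_knot K /\
  exists f : continuousType (sphere3 R) (sphere3 R),
    homeomorphism f /\ orientation_preserving f /\
    (exists2 n : nat, (1 < n)%N & has_order f n) /\
    [/\ f @` K = K,
        homeomorphic (set_type (fixed_set f)) (set_type (sphere1 R))
      & fixed_set f `&` K = set0].

Definition expi (R : realType) (t : R) : R[i] := cos t +i* sin t.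

Definition phi (R : realType) (N p q : nat) (a b : R[i]) (delta : R)
    (z : R[i]) : R[i]^o * R[i]^o :=
  (z ^+ N,
   a * (z ^+ q - z^* ^+ q) +
   b * (expi delta * z ^+ p + expi (- delta) * z^* ^+ p)).

(* [r theta] is the only s in (0, 1] such that the point of modulus s and
   argument theta is mapped to the sphere. *)
Definition admissible (R : realType) (N p q : nat) (a b : R[i]) (delta : R) :
    Prop :=
  {in closed_disk R &, injective (phi N p q a b delta)} /\
  exists r : R -> R, continuous r /\
    forall theta s : R,
      (0 < s <= 1 /\ sphere3 R (phi N p q a b delta (s%:C * expi theta)))
      <-> s = r theta.

Definition simple_minimal_knot (R : realType) (N p q : nat) (a b : R[i])
    (delta : R) : set (sphere3 R) :=
  [set w | exists2 z, closed_disk R z & set_val w = phi N p q a b delta z].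

(* Main.v *)
Require Import Defs.
From HB Require Import structures.
From mathcomp Require Import all_boot all_order all_algebra.
From mathcomp Require Import all_classical all_reals all_analysis.
From mathcomp.real_closed Require Import complex.
From mathcomp.multinomials Require Import freeg.
From mathcomp Require Import zify lra.

(* Let d = gcd(p, q) and zeta = exp(2 i pi / d). Replacing z by zeta z does not
   change z^p and z^q and multiplies z^N by zeta^N, a primitive d-th root of
   unity since N and d are coprime. Hence (u, v) |-> (zeta^N u, v) preserves K,
   has order d, and fixes exactly the circle u = 0, which misses K because
   z^N = 0 only at z = 0, which is sent to the origin. It is isotopic to the
   identity through rotations of u, so it acts trivially on homology, by the
   prism operator. Finally, z |-> z / |z| and phi are continuous bijections from
   the compact set of the z in the disk with phi(z) in the 3-sphere, onto the
   circle and onto K respectively, so K is a knot. *)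

Set Implicit Arguments.
Unset Strict Implicit.
Unset Printing Implicit Defensive.

Import Order.TTheory GRing.Theory Num.Theory.
Import numFieldNormedType.Exports.

Local Open Scope classical_set_scope.
Local Open Scope ring_scope.
Local Open Scope complex_scope.

(* [freeg] shadows [fintype.lift]. *)
Local Notation lift := fintype.lift.

(** * Subtypes, and affine maps of standard simplices given by vertex maps *)

Lemma set_val_inj (T : Type) (A : set T) : injective (set_val : A -> T).
Proof. by move=> x y; rewrite set_valE; exact: val_inj. Qed.

Lemma continuous_pair (T U V : topologicalType) (f : T -> U) (g : T -> V) :
  continuous f -> continuous g -> continuous (fun x => (f x, g x)).
Proof. by move=> cf cg x; apply: cvg_pair; [exact: cf|exact: cg]. Qed.

(** The affine function equal to 1 on the vertices in [P] and to 0 on the others. It serves both for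
    the coordinates of a simplicial map, [P] being a fibre of the vertex map, and for the height in
    a prism. *)
Definition weight (R : realType) (n : nat) (P : pred 'I_n.+1)
    (x : simplex R n) : R :=
  \sum_(i | P i) set_val x ord0 i.

Lemma continuous_coord_simplex (R : realType) (n : nat) (i : 'I_n.+1) :
  continuous (fun x : simplex R n => set_val x ord0 i).
Proof.
move=> x; apply: (@continuous_comp _ _ _ set_val
  (fun M : 'rV[R]_n.+1 => M ord0 i)).
  exact: initial_continuous.
exact: coord_continuous.
Qed.

Lemma continuous_weight (R : realType) (n : nat) (P : pred 'I_n.+1) :
  continuous (@weight R n P).
Proof.
apply: (continuous_big (op := +%R)) => [|i _]; first exact: add_continuous.
exact: continuous_coord_simplex.
Qed.

(** The affine map sending the [i]-th vertex to the [g i]-th one. *)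
Definition push_fun (R : realType) (m n : nat) (g : 'I_m.+1 -> 'I_n.+1)
    (x : simplex R m) : 'rV[R]_n.+1 :=
  \row_j weight (fun i => g i == j) x.

Lemma push_in (R : realType) (m n : nat) (g : 'I_m.+1 -> 'I_n.+1)
  (x : simplex R m) : push_fun g x \in simplex R n.
Proof.
have [x0 x1] := set_valP x; apply/mem_set; split=> [j|].
  by rewrite mxE; apply: sumr_ge0.
rewrite -[RHS]x1 (partition_big g xpredT) //=.
by apply: eq_bigr => j _; rewrite mxE.
Qed.

Definition push (R : realType) (m n : nat) (g : 'I_m.+1 -> 'I_n.+1)
    (x : simplex R m) : simplex R n :=
  exist _ (push_fun g x) (push_in g x).

Lemma set_val_push (R : realType) (m n : nat) (g : 'I_m.+1 -> 'I_n.+1)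
  (x : simplex R m) : set_val (push g x) = push_fun g x.
Proof. by rewrite set_valE. Qed.

(** The sum over the [i] with [P (g i)] is grouped according to the value of [g i]. *)
Lemma weight_push (R : realType) (m n : nat) (g : 'I_m.+1 -> 'I_n.+1)
  (P : pred 'I_n.+1) (x : simplex R m) :
  weight P (push g x) = weight (P \o g) x.
Proof.
rewrite /weight (partition_big g P) //= set_val_push.
apply: eq_bigr => j Pj; rewrite mxE; apply: eq_bigl => i.
by have [->|] := eqVneq (g i) j; rewrite ?andbF ?Pj.
Qed.

Lemma eq_weight (R : realType) (n : nat) (P Q : pred 'I_n.+1)
  (x : simplex R n) : P =1 Q -> weight P x = weight Q x.
Proof. by move=> PQ; apply: eq_bigl. Qed.

Lemma simplex_inj (R : realType) (n : nat) (x y : simplex R n) :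
  (forall i, set_val x ord0 i = set_val y ord0 i) -> x = y.
Proof.
by move=> xy; apply: set_val_inj; apply/rowP.
Qed.

Lemma push_comp (R : realType) (l m n : nat) (g : 'I_m.+1 -> 'I_n.+1)
  (h : 'I_l.+1 -> 'I_m.+1) (x : simplex R l) :
  push g (push h x) = push (g \o h) x.
Proof. by apply: simplex_inj => i; rewrite !set_val_push !mxE weight_push. Qed.

Lemma eq_push (R : realType) (m n : nat) (g h : 'I_m.+1 -> 'I_n.+1)
  (x : simplex R m) : g =1 h -> push g x = push h x.
Proof.
move=> gh; apply: simplex_inj => i; rewrite !set_val_push !mxE.
by apply: eq_weight => j; rewrite gh.
Qed.

Lemma push_id (R : realType) (n : nat) (x : simplex R n) : push id x = x.
Proof.
by apply: simplex_inj => i; rewrite set_val_push mxE /weight big_pred1_eq.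
Qed.

(** Turns compositions with faces into compositions of vertex maps, through [push_comp]. *)
Lemma faceE (R : realType) (n : nat) (i : 'I_n.+2) (x : simplex R n) :
  face i x = push (lift i) x.
Proof.
apply: simplex_inj => j; rewrite set_val_push mxE set_valE mxE /weight.
case: unliftP => [k ->|->].
  by rewrite (big_pred1 k) // => l; rewrite (inj_eq lift_inj).
by rewrite big_pred0 // => l; rewrite eq_sym (negbTE (neq_lift _ _)).
Qed.

Lemma continuous_push (R : realType) (m n : nat) (g : 'I_m.+1 -> 'I_n.+1) :
  continuous (@push R m n g).
Proof.
apply: continuous_comp_initial => x A [P xP PA].
have xP' k j : \forall y \near x, P k j (push_fun g y k j).
  have coordc : continuous (fun y : simplex R m => push_fun g y k j).
    under eq_fun do rewrite mxE.
    exact: continuous_weight.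
  exact: (coordc x _ (xP k j)).
(* There are finitely many entries, so the neighbourhoods found for each of them have a common
   refinement. *)
have : \forall y \near x, forall k j, P k j (push_fun g y k j).
  apply: (@filter_forall _ _ (fun k y => forall j,
    P k j (push_fun g y k j)) (nbhs x)) => k.
  exact: (@filter_forall _ _ (fun j y =>
    P k j (push_fun g y k j)) (nbhs x)) (xP' k).
by apply: filterS => y Py; apply: PA => k j; exact: Py.
Qed.

(** * Singular simplices of a prism *)

Section Prism.
Context (R : realType) (X Y : topologicalType).
Context (H : continuousType (X * R)%type Y).

(* The simplices of the prism are all of this form, [g] being the vertex map of
   the projection to the base and [P] the set of the vertices at height 1; the
   simplicial identities then reduce to identities between maps of ordinals. *)
Definition prism_fun m n (g : 'I_m.+1 -> 'I_n.+1) (P : pred 'I_m.+1)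
    (s : singular_simplex R n X) (x : simplex R m) : Y :=
  H (s (push g x), weight P x).

Lemma continuous_prism m n (g : 'I_m.+1 -> 'I_n.+1) (P : pred 'I_m.+1)
  (s : singular_simplex R n X) : continuous (prism_fun g P s).
Proof.
move=> x; apply: (@continuous_comp _ _ _ (fun x => (s (push g x), weight P x))
  H).
  apply: continuous_pair; last exact: continuous_weight.
  by move=> y; apply: continuous_comp; [exact: continuous_push|exact: cts_fun].
exact: cts_fun.
Qed.

Definition prism m n (g : 'I_m.+1 -> 'I_n.+1) (P : pred 'I_m.+1)
    (s : singular_simplex R n X) : singular_simplex R m Y :=
  mkcts (@continuous_prism _ _ g P s).

Lemma prism_face m n (g : 'I_m.+2 -> 'I_n.+1) (P : pred 'I_m.+2)
  (s : singular_simplex R n X) (j : 'I_m.+2) :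
  (prism g P s \o face j : singular_simplex R m Y) =
  prism (g \o lift j) (P \o lift j) s.
Proof.
by apply/continuousEP => x /=; rewrite /mkcts /prism_fun faceE push_comp
  weight_push.
Qed.

Lemma face_prism m n (g : 'I_m.+1 -> 'I_n.+1) (P : pred 'I_m.+1)
  (s : singular_simplex R n.+1 X) (j : 'I_n.+2) :
  prism g P (s \o face j : singular_simplex R n X) =
  prism (lift j \o g) P s.
Proof.
by apply/continuousEP => x /=; rewrite /mkcts /prism_fun /= faceE push_comp.
Qed.

Lemma eq_prism m n (g h : 'I_m.+1 -> 'I_n.+1) (P Q : pred 'I_m.+1)
  (s : singular_simplex R n X) : g =1 h -> P =1 Q -> prism g P s = prism h Q s.
Proof.
move=> gh PQ; apply/continuousEP => x /=; rewrite /mkcts /prism_fun.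
by rewrite (eq_push _ gh) (eq_weight _ PQ).
Qed.

End Prism.

(* The terms below and above the diagonals of the prism decomposition
   reassemble into the prism of the boundary, and the two diagonals telescope. *)
Lemma prism_sum (V : lmodType int) (n : nat) (D E : nat -> nat -> V)
    (K : nat -> V) :
  (forall i j, (j < i <= n)%N -> D i j = E i.-1 j) ->
  (forall i, (i <= n)%N -> D i i = K i) ->
  (forall i, (i <= n)%N -> D i i.+1 = K i.+1) ->
  (forall i j, (i.+1 < j <= n.+1)%N -> D i j = E i j.-1) ->
  \sum_(0 <= i < n.+1) (-1) ^+ i *: (\sum_(0 <= j < n.+2) (-1) ^+ j *: D i j) =
  K 0%N - K n.+1 -
  \sum_(0 <= j < n.+1) (-1) ^+ j *: (\sum_(0 <= i < n) (-1) ^+ i *: E i j).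
Proof.
move=> Dlt Dii DiS Dgt.
pose S i j : V := (-1) ^+ (i + j) *: E i j.
(* Row [i] is cut at [j = i] and [j = i + 1]. These two terms get the signs 1 and -1; elsewhere an
   index drops by one, which flips the sign. *)
have DE i : (0 <= i < n.+1)%N ->
  (-1) ^+ i *: (\sum_(0 <= j < n.+2) (-1) ^+ j *: D i j) =
  (\sum_(0 <= j < i) - S i.-1 j - \sum_(i.+1 <= j < n.+1) S i j) +
  (K i - K i.+1).
  move=> lein.
  rewrite (big_cat_nat (n := i)) //=; last by lia.
  rewrite (big_ltn (m := i)); last by lia.
  rewrite (big_ltn (m := i.+1)); last by lia.
  rewrite Dii ?DiS; [|lia|lia].
  rewrite !scalerDr !scalerA exprS mulrCA -expr2 sqrr_sign mulr1 scaleN1r.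
  rewrite scale1r.
  rewrite !scaler_sumr -sumrN [RHS]addrAC -!addrA.
  congr (_ + (_ + (_ + _))).
    apply: eq_big_nat => j ij; rewrite Dlt; last by lia.
    rewrite /S scalerA -exprD -scaleNr.
    by case: i ij {lein} => // i _; rewrite addSn exprS mulN1r.
  rewrite big_add1 /=; apply: eq_big_nat => j ij.
  rewrite Dgt; last by lia.
  by rewrite scalerA -exprD addnS exprS mulN1r scaleNr.
rewrite (eq_big_nat _ _ DE) !big_split /= addrC; congr (_ + _).
  rewrite -big_split (@telescope_sumr_eq _ 0 n.+1 (\- K)) //= => [|k _].
    by rewrite opprK addrC.
  by rewrite opprK addrC.
(* Row 0 has nothing below the diagonals and row [n] nothing above them. Dropping these and shifting
   the lower part leaves two complementary triangles in the range of [E]. *)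
rewrite [X in X + _]big_nat_recl // [X in (X + _) + _]big_geq // add0r.
rewrite [X in _ + X]big_nat_recr //= [\sum_(n.+1 <= j < _) _]big_geq //.
rewrite oppr0 addr0.
under [X in _ = - X]eq_bigr do rewrite scaler_sumr.
rewrite [X in _ = - X]exchange_big_nat -big_split -sumrN /=.
apply: eq_big_nat => i lein.
rewrite [X in _ = - X](big_cat_nat (n := i.+1)) //=; last by lia.
rewrite sumrN -opprD; congr (- (_ + _)); apply: eq_bigr => j _.
  by rewrite /S scalerA -exprD addnC.
by rewrite /S scalerA -exprD addnC.
Qed.

(** * Linear extension from the basis of a free abelian group *)

HB.instance Definition _ (R : ringType) (K : choiceType) (M : lmodType R)
    (f : K -> M) :=
  GRing.isAdditive.Build {freeg K / R} M (fglift f) (lift_is_additive f).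

Lemma fgliftZ (K : choiceType) (M : lmodType int) (f : K -> M) (a : int) :
  {morph fglift f : c / a *: c}.
Proof. by move=> c; rewrite -[a]intz !scaler_int raddfMz. Qed.

Lemma fglift1 (R : ringType) (K : choiceType) (M : lmodType R) (f : K -> M)
  (x : K) : fglift f << x >> = f x.
Proof. by rewrite liftU scale1r. Qed.

(** Closure under subtraction yields opposites, sums and integer multiples, hence all combinations
    of generators. Identities between additive maps of chains can thus be checked on single
    simplices. *)
Lemma freeg_zmod_ind (K : choiceType) (P : {freeg K / int} -> Prop) :
  P 0 -> (forall x, P << x >>) -> (forall c d, P c -> P d -> P (c - d)) ->
  forall c, P c.
Proof.
move=> P0 P1 PB.
have PN c : P c -> P (- c) by move=> Pc; rewrite -sub0r; exact: PB.
have PD c d : P c -> P d -> P (c + d).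
  by move=> Pc Pd; rewrite -[d]opprK; apply: PB => //; exact: PN.
have PMn c n : P c -> P (c *+ n).
  by move=> Pc; elim: n => // n IHn; rewrite mulrS; exact: PD.
apply: freeg_ind_dom0 => // k x c _ _ Pc; apply: PD => //.
rewrite -[k]intz -freegU_mulz.
by case: k => n; [exact: PMn|apply: PN; exact: PMn].
Qed.

(** * The prism operator and homotopy invariance *)

Section PrismOperator.
Context (R : realType) (X Y : topologicalType).
Context (H : continuousType (X * R)%type Y).

(* The [i]-th simplex [v_0, ..., v_i, w_i, ..., w_n] of the prism projects to
   the base [v_0, ..., v_n] by [degen i]; [above i] are its vertices [w_j]. *)
Definition degen n (i : nat) (j : 'I_n.+2) : 'I_n.+1 := inord (unbump i j).
Arguments degen {n} i j.

(** The bound makes [inord] faithful: the last index [n + 1] exceeds [i], so [unbump] lowers it to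
    [n]. *)
Lemma degenE n (i : nat) (j : 'I_n.+2) :
  (i <= n)%N -> degen i j = unbump i j :> nat.
Proof. by move=> lein; rewrite inordK // /unbump; move: (ltn_ord j); lia. Qed.

Lemma lift_inordE n (j : nat) (k : 'I_n.+1) :
  (j <= n.+1)%N -> lift (inord j : 'I_n.+2) k = bump j k :> nat.
Proof. by move=> lejn; rewrite /= inordK. Qed.

Definition above n (i : nat) : pred 'I_n.+1 := fun j => (i < j)%N.

Definition prism_simplex n (s : singular_simplex R n X) (i : nat) :
    singular_simplex R n.+1 Y :=
  prism H (degen i) (above i) s.

Definition prism_operator n : singular_chain R n X -> singular_chain R n.+1 Y :=
  fglift (fun s => \sum_(0 <= i < n.+1) (-1) ^+ i *:
    (<< prism_simplex s i >> : singular_chain R n.+1 Y)).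

(** Natural number indices replace ordinals here to match [prism_sum]. *)
Lemma boundary1 n (Z : topologicalType) (s : singular_simplex R n.+1 Z) :
  boundary << s >> = \sum_(0 <= j < n.+2) (-1) ^+ j *:
    (<< (s \o @face R n (inord j) : singular_simplex R n Z) >> :
      singular_chain R n Z).
Proof.
rewrite /boundary fglift1 big_mkord; apply: eq_bigr => j _.
by rewrite inord_val.
Qed.

Lemma boundary_prism_simplex n (s : singular_simplex R n.+1 X) (i : nat) :
  boundary (<< prism_simplex s i >> : singular_chain R n.+2 Y) =
  \sum_(0 <= j < n.+3) (-1) ^+ j *:
    (<< prism H (degen i \o lift (inord j)) (above i \o lift (inord j)) s >> :
      singular_chain R n.+1 Y).
Proof.
rewrite boundary1; apply: eq_bigr => j _.
by congr (_ *: << _ >>); apply: prism_face.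
Qed.

Lemma prism_operator_boundary n (s : singular_simplex R n.+1 X) :
  prism_operator (boundary << s >>) =
  \sum_(0 <= j < n.+2) (-1) ^+ j *: \sum_(0 <= i < n.+1) (-1) ^+ i *:
    (<< prism H (lift (inord j) \o degen i) (above i) s >> :
      singular_chain R n.+1 Y).
Proof.
rewrite boundary1 /prism_operator raddf_sum; apply: eq_bigr => j _ /=.
rewrite fgliftZ fglift1; congr (_ *: _).
apply: eq_bigr => i _; congr (_ *: << _ >>); exact: face_prism.
Qed.

(** The chain homotopy formula. On a simplex it is [prism_sum], applied to the faces of the prism
    simplices. *)
Lemma boundary_prism_operator n (f g : continuousType X Y) :
  (forall x, H (x, 0) = g x) -> (forall x, H (x, 1) = f x) ->
  forall c : singular_chain R n.+1 X,
  boundary (prism_operator c) =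
  chain_map f c - chain_map g c - prism_operator (boundary c).
Proof.
move=> H0 H1; elim/freeg_zmod_ind.
- by rewrite /boundary /chain_map /prism_operator !raddf0 !addr0.
- move=> s; rewrite prism_operator_boundary /chain_map !fglift1.
  rewrite /prism_operator fglift1 {1}/boundary raddf_sum /=.
  under eq_bigr => i _ do
    rewrite fgliftZ -[fglift _ _]/(boundary _) boundary_prism_simplex.
  (* [E i j] is the [i]-th prism simplex over the [j]-th face. [K i] is the section of the prism
     whose vertices of index at least [i] are at height 1, so the first one is the top and the last
     one the bottom. *)
  rewrite (@prism_sum _ n.+1 _
    (fun i j => << prism H (lift (inord j) \o degen i) (above i) s >>)
    (fun i => << prism H id (fun k => (i <= k)%N) s >>)) /=.
  + congr (<< _ >> - << _ >> - _); apply/continuousEP => x /=.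
    * rewrite /mkcts /prism_fun push_id (_ : weight _ x = 1) ?H1 //.
      by have [_] := set_valP x.
    * rewrite /mkcts /prism_fun push_id (_ : weight _ x = 0) ?H0 //.
      by rewrite /weight big_pred0 // => k; rewrite leqNgt ltn_ord.
  + move=> i j jin; congr << _ >>; apply: eq_prism => k /=.
      apply: ord_inj; move: (ltn_ord k) => ltk.
      by rewrite degenE ?lift_inordE ?degenE /bump /unbump; lia.
    by rewrite /above lift_inordE /bump; lia.
  (* Omitting [v_i] leaves [v_0, ..., v_(i-1), w_i, ...], the section [K i]. In the next case,
     omitting [w_i] leaves [v_0, ..., v_i, w_(i+1), ...], the section [K i.+1]. *)
  + move=> i lein; congr << _ >>; apply: eq_prism => k /=.
      apply: ord_inj; move: (ltn_ord k) => ltk.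
      by rewrite degenE ?lift_inordE /bump /unbump; lia.
    by rewrite /above lift_inordE /bump; lia.
  + move=> i lein; congr << _ >>; apply: eq_prism => k /=.
      apply: ord_inj; move: (ltn_ord k) => ltk.
      by rewrite degenE ?lift_inordE /bump /unbump; lia.
    by rewrite /above lift_inordE /bump; lia.
  + move=> i j jin; congr << _ >>; apply: eq_prism => k /=.
      apply: ord_inj; move: (ltn_ord k) => ltk.
      by rewrite degenE ?lift_inordE ?degenE /bump /unbump; lia.
    by rewrite /above lift_inordE /bump; lia.
move=> c d; rewrite /boundary /chain_map /prism_operator !raddfB /= => -> ->.
by rewrite !opprD [LHS]addrACA [X in X + _ = _]addrACA.
Qed.
End PrismOperator.

(** On a cycle the term with the boundary vanishes, so the prism over [c] bounds the difference. The
    parameter of [H] is any real, but only heights in [0, 1] are evaluated. *)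
Lemma homotopic_homology_identity (R : realType) (n : nat) (X : topologicalType)
  (f : continuousType X X) (H : continuousType (X * R)%type X) :
  (forall x, H (x, 0) = x) -> (forall x, H (x, 1) = f x) ->
  homology_identity R n f.
Proof.
move=> H0 H1 c bc0; exists (prism_operator H c).
rewrite (@boundary_prism_operator _ _ _ _ _ f idfun) // bc0.
rewrite /prism_operator raddf0 subr0; congr (_ - _).
move: c {bc0}; elim/freeg_zmod_ind => [|s|c d].
- by rewrite /chain_map raddf0.
- by rewrite /chain_map fglift1; congr << _ >>; apply/continuousEP.
- by rewrite /chain_map raddfB => /= -> ->.
Qed.

(** * Compactness, separation and homeomorphisms *)

(** A filter on the subtype is pushed forward to [X], where it clusters at a point of [A]; open sets
    of the subtype being preimages, it clusters there in the subtype too. *)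
Lemma compact_setT (X : topologicalType) (A : set X) :
  compact A -> compact [set: set_type A].
Proof.
move=> cA F FF _.
have FA : ((set_val : A -> X) @ F) A.
  rewrite /fmap /= (_ : _ @^-1` _ = setT); first exact: filterT.
  by apply/seteqP; split=> x // _; exact: set_valP.
have [x [Ax clx]] := cA _ _ FA.
exists (exist _ x (mem_set Ax)); split=> // B U FB [_ [[W oW <-] /= Wx] WU].
have [||y [[z Bz <-] Wz]] := clx ((set_val : A -> X) @` B) W.
- by apply: (@filterS _ F _ _ _ _ FB) => z Bz; exists z.
- by apply: open_nbhs_nbhs; split => //; move: Wx; rewrite set_valE.
- by by exists z; split => //; exact: WU.
Qed.

Lemma inj_hausdorff (X Y : topologicalType) (f : X -> Y) :
  continuous f -> injective f -> hausdorff_space Y -> hausdorff_space X.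
Proof.
move=> cf injf hY x y xy; apply: injf; apply: hY => A B Ax By.
have [z [Az Bz]] := xy _ _ (cf x A Ax) (cf y B By).
by exists (f z).
Qed.

Lemma set_type_hausdorff (X : topologicalType) (A : set X) :
  hausdorff_space X -> hausdorff_space (set_type A).
Proof.
apply: (inj_hausdorff (f := set_val)); first exact: initial_continuous.
exact: set_val_inj.
Qed.

(** The map is closed: a closed set is compact, so its image is compact in a Hausdorff space. This
    image is the preimage by the inverse. *)
Lemma compact_homeomorphism (X Y : topologicalType) (f : X -> Y) :
  compact [set: X] -> hausdorff_space Y -> continuous f -> injective f ->
  (forall y, exists x, f x = y) -> homeomorphism f.
Proof.
move=> cX hY cf injf /choice[g gK]; split => //; exists g.
have fK : cancel f g by move=> x; apply: injf; rewrite gK.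
split => //; apply/continuous_closedP => A cA.
have -> : g @^-1` A = f @` A.
  apply/seteqP; split=> [y Ay|_ [x Ax <-]]; last by rewrite /preimage /= fK.
  by exists (g y) => //; rewrite gK.
apply: compact_closed => //; apply: continuous_compact.
  exact: continuous_subspaceT.
exact: (subclosed_compact cA cX).
Qed.

Lemma homeomorphic_sym (X Y : topologicalType) :
  homeomorphic X Y -> homeomorphic Y X.
Proof. by move=> [f [cf [g [cg fK gK]]]]; exists g; split => //; exists f. Qed.

Lemma homeomorphic_trans (X Y Z : topologicalType) :
  homeomorphic X Y -> homeomorphic Y Z -> homeomorphic X Z.
Proof.
move=> [f [cf [f' [cf' fK f'K]]]] [g [cg [g' [cg' gK g'K]]]].
exists (g \o f); split.
  by move=> x; apply: continuous_comp; [exact: cf|exact: cg].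
exists (f' \o g'); split; [|exact: can_comp|exact: can_comp].
by move=> x; apply: continuous_comp; [exact: cg'|exact: cf'].
Qed.

Lemma continuous_set_val (X : topologicalType) (A : set X) :
  continuous (set_val : A -> X).
Proof. exact: initial_continuous. Qed.

Lemma sqr_sum_le1 (R : realDomainType) (x y : R) :
  x ^+ 2 + y ^+ 2 <= 1 -> -1 <= x <= 1.
Proof. by move=> xy1; have y2 := sqr_ge0 y; apply/andP; split; nra. Qed.

(** * Continuity, closedness and compactness in the complex plane *)

Section ComplexTopology.
Context (R : realType).

Lemma continuous_conjc : continuous (fun z : R[i]^o => z^* : R[i]^o).
Proof.
move=> z; apply/(@cvgrPdist_lt _ R[i]^o _ (nbhs z)) => e e0; near=> w.
rewrite -rmorphB normcJ; near: w.
exact: (@cvgr_dist_lt _ R[i]^o _ (nbhs z) _ id z).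
Unshelve. all: by end_near. Qed.

Lemma continuous_real_complex : continuous (fun x : R => x%:C : R[i]^o).
Proof.
(* The radius [e] is a complex number; being positive, it has zero imaginary part, which reduces the
   claim to real radii. *)
move=> x; apply/(@cvgrPdist_lt _ R[i]^o _ (nbhs x)) => e; rewrite ltcE.
move=> /andP[/eqP ei er]; near=> y.
rewrite -rmorphB normc_def /= expr0n addr0 sqrtr_sqr ltcE /= ei eqxx /=.
near: y.
exact: (@cvgr_dist_lt _ R _ (nbhs x) _ id x).
Unshelve. all: by end_near. Qed.

Lemma continuous_Complex : continuous (fun u : R * R => u.1 +i* u.2 : R[i]^o).
Proof.
have -> : (fun u : R * R => u.1 +i* u.2 : R[i]^o) =
  (fun u => u.1%:C + 'i%C * u.2%:C).
  by apply/funext => u; rewrite [LHS]complexE.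
move=> u; apply: cvgD.
  apply: (@continuous_comp _ _ _ fst (fun x : R => x%:C : R[i]^o)).
    exact: cvg_fst.
  exact: continuous_real_complex.
apply: cvgM; first exact: cvg_cst.
apply: (@continuous_comp _ _ _ snd (fun x : R => x%:C : R[i]^o)).
  exact: cvg_snd.
exact: continuous_real_complex.
Qed.

Lemma continuous_expi : continuous (@expi R : R -> R[i]^o).
Proof.
move=> t; apply: (@continuous_comp _ _ _ (fun t : R => (cos t, sin t))
  (fun u => u.1 +i* u.2 : R[i]^o)); last exact: continuous_Complex.
by apply: continuous_pair; [exact: continuous_cos|exact: continuous_sin].
Qed.

Lemma norm_complex_le1 (x y : R) :
  (`|x +i* y| <= 1) = (x ^+ 2 + y ^+ 2 <= 1).
Proof.
by rewrite normc_def lecR /= -[leRHS]sqrtr1 ler_sqrt // ltr01.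
Qed.

(** Compactness is transported from the real plane, where the disk is closed in the square with
    sides [-1, 1]. *)
Lemma closed_disk_compact : compact (closed_disk R : set R[i]^o).
Proof.
pose D : set (R * R) := (fun u => u.1 ^+ 2 + u.2 ^+ 2) @^-1` [set t | t <= 1].
have -> : (closed_disk R : set R[i]^o) =
    (fun u : R * R => u.1 +i* u.2 : R[i]^o) @` D.
  apply/seteqP; split=> [[x y]|_ [[x y] Dxy <-]].
    rewrite /closed_disk /= norm_complex_le1 => Dxy.
    by exists (x, y).
  by rewrite /closed_disk /= norm_complex_le1.
apply: continuous_compact.
  exact/continuous_subspaceT/continuous_Complex.
apply: (@subclosed_compact _ _ (`[-1 : R, 1] `*` `[-1 : R, 1])).
- apply: preimage_closed; last exact: closed_le.
  move=> u _; apply: (@cvgD R R _ (nbhs u)); apply: (@cvgM R _ (nbhs u));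
    by [exact: cvg_fst|exact: cvg_snd].
- by apply: compact_setX; exact: segment_compact.
- move=> [x y]; rewrite /D /= => xy1.
  split; rewrite /= in_itv /=; first exact: sqr_sum_le1 xy1.
  by rewrite addrC in xy1; exact: sqr_sum_le1 xy1.
Qed.

Lemma continuous_exprn (n : nat) :
  continuous (fun z : R[i]^o => z ^+ n : R[i]^o).
Proof.
move=> z; elim: n => [|n IHn].
  under eq_fun do rewrite expr0.
  exact: cst_continuous.
under eq_fun do rewrite exprS.
apply: (@cvgM R[i] _ (nbhs z)); [exact: cvg_id|exact: IHn].
Qed.

Lemma continuous_phi (N p q : nat) (a b : R[i]) (delta : R) :
  continuous (phi N p q a b delta : R[i]^o -> _).
Proof.
have cJ n : continuous (fun z : R[i]^o => z^* ^+ n : R[i]^o).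
  move=> z; apply: (@continuous_comp _ _ _ (fun z : R[i]^o => z^* : R[i]^o)
    (fun z : R[i]^o => z ^+ n : R[i]^o)).
    exact: continuous_conjc.
  exact: continuous_exprn.
apply: continuous_pair; first exact: continuous_exprn.
move=> z; apply: (@cvgD R[i] R[i]^o _ (nbhs z)).
  apply: (@cvgM R[i] _ (nbhs z)); first exact: cvg_cst.
  by apply: (@cvgB R[i] R[i]^o _ (nbhs z)); [exact: continuous_exprn|exact: cJ].
apply: (@cvgM R[i] _ (nbhs z)); first exact: cvg_cst.
apply: (@cvgD R[i] R[i]^o _ (nbhs z)); apply: (@cvgM R[i] _ (nbhs z));
  try exact: cvg_cst.
  exact: continuous_exprn.
exact: cJ.
Qed.

Lemma sphere3_closed : closed (sphere3 R).
Proof.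
pose F (w : R[i]^o * R[i]^o) : R[i]^o :=
  `|w.1 : R[i]| ^+ 2 + `|w.2 : R[i]| ^+ 2.
rewrite (_ : sphere3 R = F @^-1` [set 1]) //.
apply: preimage_closed; last first.
  by apply: compact_closed; [exact: norm_hausdorff|exact: compact_set1].
have cn2 : continuous (fun z : R[i]^o => (`|z : R[i]| ^+ 2 : R[i]^o)).
  move=> z; apply: (@cvgM R[i] _ (nbhs z)); exact: (@norm_continuous _ R[i]^o).
move=> w _; apply: (@cvgD R[i] R[i]^o _ (nbhs w)).
  apply: (@continuous_comp _ _ _ fst
    (fun z : R[i]^o => `|z : R[i]| ^+ 2 : R[i]^o)).
    exact: cvg_fst.
  exact: cn2.
apply: (@continuous_comp _ _ _ snd
  (fun z : R[i]^o => `|z : R[i]| ^+ 2 : R[i]^o)).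
  exact: cvg_snd.
exact: cn2.
Qed.

End ComplexTopology.

(** * Parametrisation of the unit circle by angles *)

Section CircleArguments.
Context (R : realType).

Lemma expiD (s t : R) : expi (s + t) = expi s * expi t.
Proof. by rewrite /expi cosD sinD; simpc; congr (_ +i* _); rewrite addrC. Qed.

Lemma expi0 : expi (0 : R) = 1.
Proof. by rewrite /expi cos0 sin0. Qed.

Lemma expiN (t : R) : expi (- t) = (expi t)^-1.
Proof. by apply/esym/mulr1_eq; rewrite -expiD subrr expi0. Qed.

Lemma norm_expi (t : R) : `|expi t| = 1.
Proof. by rewrite normc_def /= cos2Dsin2 sqrtr1. Qed.

Lemma expiMn (t : R) (n : nat) : expi (t *+ n) = expi t ^+ n.
Proof.
elim: n => [|n IHn]; first by rewrite mulr0n expi0.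
by rewrite mulrS expiD IHn exprS.
Qed.

(** [acos] of the real part is the argument up to sign; the sign of the imaginary part decides. *)
Lemma expi_surj (z : R[i]) : `|z| = 1 -> exists t, z = expi t.
Proof.
case: z => x y; rewrite normc_def => -[] /= xy1.
have {}xy1 : x ^+ 2 + y ^+ 2 = 1.
  by rewrite -[LHS]sqr_sqrtr ?addr_ge0 ?sqr_ge0 // xy1 expr1n.
have x1 : -1 <= x <= 1 by apply: (@sqr_sum_le1 _ x y); rewrite xy1.
have cx : cos (acos x) = x by apply: acosK; rewrite in_itv.
have sx : sin (acos x) = `|y|.
  by rewrite sin_acos // -xy1 addrC addKr sqrtr_sqr.
have [y0|y0] := leP 0 y.
  by exists (acos x); rewrite /expi cx sx ger0_norm.
by exists (- acos x); rewrite /expi cosN sinN cx sx ltr0_norm // opprK.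
Qed.

End CircleArguments.

(** * Primitive roots of unity *)

Section Roots.
Context (R : realType).

(** By the double angle formula, [expi t = 1] would force [sin (t / 2) = 0], whereas the sine is
    positive between 0 and pi. *)
Lemma expi_neq1 (t : R) : 0 < t < pi *+ 2 -> expi t <> 1.
Proof.
move=> /andP[t0 t2pi] t1.
have s0 : 0 < sin (t / 2)
    by apply: sin_gt0_pi; rewrite divr_gt0 // ltr_pdivrMr // mulr_natr.
move: t1; rewrite [t]splitr expiD /expi; simpc.
move=> [c2 _]; have := cos2Dsin2 (t / 2); nra.
Qed.

Lemma expi2pi : expi (pi *+ 2 : R) = 1.
Proof. by rewrite /expi cos2pi sin2pi. Qed.

Lemma primitive_root_expi (d : nat) :
  (0 < d)%N -> d.-primitive_root (expi (pi *+ 2 / d%:R : R)).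
Proof.
move=> d0; rewrite /primitive_root_of_unity d0; apply/forallP => i.
have dR : (0 : R) < d%:R by rewrite ltr0n.
rewrite unity_rootE -expiMn -[_ *+ i.+1]mulr_natr mulrAC; apply/eqP.
have [->|neq] := eqVneq i.+1 d.
  by rewrite mulfK ?lt0r_neq0 // expi2pi !eqxx.
apply/negbTE/eqP/expi_neq1.
have ltid : (i.+1 < d)%N by rewrite ltn_neqAle neq ltn_ord.
have pi2 : (0 : R) < pi *+ 2 by rewrite pmulrn_lgt0 // pi_gt0.
rewrite divr_gt0 ?mulr_gt0 ?ltr0n //=.
by rewrite ltr_pdivrMr // ltr_pM2l // ltr_nat.
Qed.

End Roots.

(** * Rotations of the first coordinate of the 3-sphere *)

Section Rotation.
Context (R : realType).
Implicit Types (s t : R) (w : sphere3 R).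

(** A real angle, rather than a unit complex number, makes inverses, iterates and the isotopy to the
    identity mere multiples of [t]. *)
Definition rotate_fun t w : R[i]^o * R[i]^o :=
  (expi t * (set_val w).1, (set_val w).2).

Lemma rotate_in t w : rotate_fun t w \in sphere3 R.
Proof.
apply/mem_set; rewrite /sphere3 /= normrM norm_expi mul1r.
exact: (set_valP w).
Qed.

Definition rotate t w : sphere3 R := exist _ (rotate_fun t w) (rotate_in t w).

Lemma set_val_rotate t w : set_val (rotate t w) = rotate_fun t w.
Proof. by rewrite set_valE. Qed.

Lemma rotateD s t w : rotate s (rotate t w) = rotate (s + t) w.
Proof.
by apply: set_val_inj; rewrite !set_val_rotate /rotate_fun !set_val_rotate /=
  expiD mulrA.
Qed.

Lemma rotate0 w : rotate 0 w = w.
Proof.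
apply: set_val_inj; rewrite set_val_rotate /rotate_fun expi0 mul1r.
by case: (set_val w).
Qed.

Lemma iter_rotate n t w : iter n (rotate t) w = rotate (t *+ n) w.
Proof.
by elim: n => [|n IHn]; rewrite ?rotate0 // iterS IHn rotateD mulrS.
Qed.

Lemma continuous_rotate :
  continuous (fun u : sphere3 R * R => rotate u.2 u.1).
Proof.
apply: continuous_comp_initial.
pose val1 (u : sphere3 R * R) : R[i]^o * R[i]^o := set_val u.1.
have c1 : continuous val1.
  move=> u; apply: (@continuous_comp _ _ _ fst set_val); first exact: cvg_fst.
  exact: continuous_set_val.
apply: continuous_pair => u; last first.
  by apply: (@continuous_comp _ _ _ val1 snd); [exact: c1|exact: cvg_snd].
apply: (@cvgM R[i] _ (nbhs u)).
  apply: (@continuous_comp _ _ _ snd (@expi R : R -> R[i]^o)).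
    exact: cvg_snd.
  exact: continuous_expi.
by apply: (@continuous_comp _ _ _ val1 fst); [exact: c1|exact: cvg_fst].
Qed.

Lemma continuous_rotatel t : continuous (rotate t).
Proof.
move=> w; apply: (@continuous_comp _ _ _ (fun w => (w, t))
  (fun u => rotate u.2 u.1)).
  by apply: continuous_pair => ?; [exact: cvg_id|exact: cst_continuous].
exact: continuous_rotate.
Qed.

Lemma rotate_homeomorphism t : homeomorphism (rotate t).
Proof.
split; first exact: continuous_rotatel.
exists (rotate (- t)); split; first exact: continuous_rotatel.
  by move=> w; rewrite rotateD addNr rotate0.
by move=> w; rewrite rotateD subrr rotate0.
Qed.

(** The homotopy at time [s] is the rotation of angle [s * t]. *)
Lemma rotate_orientation_preserving t :
  orientation_preserving (mkcts (continuous_rotatel (t := t))).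
Proof.
have cH : continuous (fun u : sphere3 R * R => rotate (u.2 * t) u.1).
  move=> u; apply: (@continuous_comp _ _ _
    (fun u : sphere3 R * R => (u.1, u.2 * t))
    (fun u => rotate u.2 u.1)); last exact: continuous_rotate.
  apply: continuous_pair => {}u; first exact: cvg_fst.
  by apply: (@cvgM R _ (nbhs u)); [exact: cvg_snd|exact: cvg_cst].
apply: (homotopic_homology_identity (H := mkcts cH)) => w.
  by rewrite -[LHS]/(rotate (0 * t) w) mul0r rotate0.
by rewrite -[LHS]/(rotate (1 * t) w) mul1r.
Qed.

Lemma fixed_rotate t : expi t <> 1 ->
  fixed_set (rotate t) = [set w | (set_val w).1 = 0].
Proof.
move=> t1; apply/seteqP; split=> w /=; rewrite /fixed_set /=.
  move=> /(congr1 set_val); rewrite set_val_rotate => /(congr1 fst) /= tw.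
  apply/eqP/negPn/negP => w0; apply: t1; apply: (mulIf w0).
  by rewrite tw mul1r.
move=> w0; apply: set_val_inj; rewrite set_val_rotate /rotate_fun w0 mulr0 -w0.
by case: (set_val w).
Qed.

(** The second coordinate and [v |-> (0, v)] are inverse maps between the axis and the circle. *)
Lemma fixed_rotate_circle t : expi t <> 1 ->
  homeomorphic (set_type (fixed_set (rotate t))) (set_type (sphere1 R)).
Proof.
move=> t1; have fixE := fixed_rotate t1; set F := fixed_set _ in fixE *.
have FP w : F w -> (set_val w).1 = 0 by rewrite fixE.
have F0 (x : F) : (set_val (set_val x)).1 = 0 by apply: FP; exact: set_valP.
pose f0 (x : F) : R[i]^o := (set_val (set_val x)).2.
have f_in x : f0 x \in sphere1 R.
  have : sphere3 R (set_val (set_val x)) by exact: set_valP.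
  move=> xS; apply/mem_set; move: xS.
  rewrite /sphere3 /sphere1 /= F0 normr0 expr0n add0r => /eqP.
  by rewrite sqrp_eq1 // => /eqP.
pose g0 (v : sphere1 R) : R[i]^o * R[i]^o := (0, set_val v).
have g0_in v : g0 v \in sphere3 R.
  apply/mem_set; rewrite /sphere3 /g0 /= normr0 expr0n add0r.
  have : sphere1 R (set_val v) by exact: set_valP.
  by rewrite /sphere1 /= => ->; rewrite expr1n.
pose g1 v : sphere3 R := exist _ (g0 v) (g0_in v).
have g1_in v : g1 v \in F by apply/mem_set; rewrite fixE.
exists (fun x => exist _ (f0 x) (f_in x)); split.
  apply: continuous_comp_initial => x.
  apply: (@continuous_comp _ _ _ (fun x : F => set_val (set_val x)) snd).
    by apply: (@continuous_comp _ _ _ set_val); exact: continuous_set_val.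
  exact: cvg_snd.
exists (fun v => exist _ (g1 v) (g1_in v)); split.
- do 2 apply: continuous_comp_initial.
  apply: continuous_pair; first exact: cst_continuous.
  exact: continuous_set_val.
- move=> x; apply: set_val_inj; apply: set_val_inj.
  by rewrite [RHS]surjective_pairing F0.
- by move=> v; exact: set_val_inj.
Qed.

End Rotation.

(** * The knot and its symmetries *)

Section Knot.
Context (R : realType) (N p q : nat) (a b : R[i]) (delta : R).
Context (N0 : (0 < N)%N) (p0 : (0 < p)%N) (q0 : (0 < q)%N).

Local Notation phi := (phi N p q a b delta).
Local Notation K := (simple_minimal_knot N p q a b delta).

Lemma phi0 : phi 0 = (0, 0).
Proof.
rewrite /Defs.phi rmorph0 !expr0n !gtn_eqF //.
by rewrite subrr !mulr0 addr0 mulr0 addr0.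
Qed.

(** Used both to divide by the modulus on the parameter set of the knot and to keep the rotation
    axis off the knot. *)
Lemma phi0_notin_sphere3 : ~ sphere3 R (phi 0).
Proof.
by rewrite phi0 /sphere3 /= normr0 expr0n addr0 => /esym/eqP; rewrite oner_eq0.
Qed.

Lemma knot_is_knot : admissible N p q a b delta -> is_knot K.
Proof.
move=> [phi_inj [r [_ rP]]].
pose Z : set R[i]^o := closed_disk R `&` phi @^-1` (sphere3 R).
have cZ : compact [set: Z].
  apply: compact_setT; apply: compact_closedI; first exact: closed_disk_compact.
  apply: preimage_closed; last exact: sphere3_closed.
  by move=> z _; exact: continuous_phi.
have Z1 (z : Z) : closed_disk R (set_val z).
  by have [] : Z (set_val z) by exact: set_valP.
have Z2 (z : Z) : sphere3 R (phi (set_val z)).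
  by have [] : Z (set_val z) by exact: set_valP.
have Zn0 (z : Z) : `|set_val z : R[i]| != 0.
  rewrite normr_eq0; apply/eqP => z0; apply: phi0_notin_sphere3.
  by rewrite -z0.
(* The uniqueness clause for [r] makes the argument of a point of [Z] determine its modulus;
   injectivity of the normalisation follows. *)
have polar (z : Z) (t : R) : set_val z / `|set_val z : R[i]| = expi t ->
    set_val z = (r t)%:C * expi t.
  move=> zt;
  have /complex_realP[s zs] : `|set_val z : R[i]| \is Num.real.
    exact: normr_real.
  have zE : set_val z = s%:C * expi t by rewrite -zt -zs mulrC divfK.
  suff <- : s = r t by [].
  apply/rP; rewrite -zE; split; last exact: Z2.
  have : 0 < `|set_val z : R[i]| <= 1.
    by rewrite lt_def Zn0 normr_ge0 Z1.
  by rewrite zs ltcR lecR.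
apply: (homeomorphic_trans (Y := set_type Z)).
  apply: homeomorphic_sym.
  pose u0 (z : Z) : R[i]^o := set_val z / `|set_val z : R[i]|.
  have u_in z : u0 z \in sphere1 R.
    by apply/mem_set; rewrite /sphere1 /u0 /= normf_div normr_id divff.
  exists (fun z => exist _ (u0 z) (u_in z)); apply: compact_homeomorphism => //.
  - by apply: set_type_hausdorff; exact: norm_hausdorff.
  - apply: continuous_comp_initial => z.
    apply: (@cvgM R[i] _ (nbhs z)); first exact: continuous_set_val.
    apply: (@cvgV R[i] _ (nbhs z)); first exact: Zn0.
    apply: (@cvg_norm _ R[i]^o); exact: continuous_set_val.
  - move=> z z' /(congr1 set_val); rewrite set_valE /= => zz'.
    have [t zt] : exists t, u0 z = expi t.
      by apply: expi_surj; have /set_mem := u_in z.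
    apply: set_val_inj; rewrite (polar _ _ zt).
    by rewrite zz' in zt; rewrite (polar _ _ zt).
  - move=> v; have [t vt] : exists t, set_val v = expi t.
      by apply: expi_surj; have : sphere1 R (set_val v) by exact: set_valP.
    have [/andP[rt0 rt1] rtS] := (rP t (r t)).2 erefl.
    have nz : `|(r t)%:C * expi t| = (r t)%:C.
      rewrite normrM norm_expi mulr1 normc_def /= expr0n addr0 sqrtr_sqr.
      by rewrite ger0_norm // ltW.
    (* The existence clause for [r] provides the preimage of [expi t]. *)
    have zZ : (r t)%:C * expi t \in Z.
      by apply/mem_set; split => //; rewrite /closed_disk /= nz lecR.
    exists (exist (fun z => z \in Z) _ zZ); apply: set_val_inj.
    rewrite -[LHS]/((r t)%:C * expi t / `|(r t)%:C * expi t|) nz vt mulrAC.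
    rewrite divff ?mul1r //.
    by rewrite fmorph_eq0 gt_eqF.
pose k0 (z : Z) : sphere3 R := exist _ (phi (set_val z)) (mem_set (Z2 z)).
have k_in z : k0 z \in K.
  by apply/mem_set; exists (set_val z) => //; rewrite set_valE.
exists (fun z => exist _ (k0 z) (k_in z)); apply: compact_homeomorphism => //.
- do 2 apply: set_type_hausdorff; exact: norm_hausdorff.
- do 2 apply: continuous_comp_initial.
  move=> z; apply: (@continuous_comp _ _ _ (set_val : Z -> R[i]^o)
    (phi : R[i]^o -> R[i]^o * R[i]^o)); first exact: continuous_set_val.
  exact: continuous_phi.
- move=> z z' /(congr1 (set_val \o set_val)) /= zz'.
  by apply: set_val_inj; apply: phi_inj => //; apply/mem_set; exact: Z1.
- move=> w; have [z zD wz] : K (set_val w) by exact: set_valP.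
  have zZ : z \in Z.
    by apply/mem_set; split => //; rewrite /= -wz; exact: set_valP.
  by exists (exist (fun z => z \in Z) z zZ); do 2 apply: set_val_inj.
Qed.

(** Stated for every common [p]-th and [q]-th root of unity, so as to cover a rotation and its
    inverse. *)
Lemma rotate_knot (s : R) (w : sphere3 R) :
  expi s ^+ p = 1 -> expi s ^+ q = 1 -> K w -> K (rotate (s *+ N) w).
Proof.
move=> sp sq [z zD wz]; exists (expi s * z).
  by rewrite /closed_disk /= normrM norm_expi mul1r.
rewrite set_val_rotate /rotate_fun wz /Defs.phi /= expiMn !exprMn.
(* The conjugate of [expi s] is also a [p]-th and [q]-th root of unity. *)
by rewrite rmorphM !exprMn -!rmorphXn sp sq /= rmorph1 !mul1r.
Qed.

End Knot.

Theorem theorem1 (R : realType) (N p q : nat) (a b : R[i]) (delta : R)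
  (hN : (2 <= N)%N) (hp : (N < p)%N) (hq : (N < q)%N)
  (hNp : gcdn N p = 1%N) (hNq : gcdn N q = 1%N)
  (hadm : admissible N p q a b delta)
  (hd : gcdn p q <> 1%N) :
  periodic_knot (simple_minimal_knot N p q a b delta).
Proof.
have N0 : (0 < N)%N by lia.
have p0 : (0 < p)%N by lia.
have q0 : (0 < q)%N by lia.
split; first exact: knot_is_knot.
set d := gcdn p q in hd; set K := simple_minimal_knot _ _ _ _ _ _.
have d0 : (0 < d)%N by rewrite gcdn_gt0 p0.
have d1 : (1 < d)%N by lia.
pose t : R := pi *+ 2 / d%:R.
have prim : d.-primitive_root (expi t) by exact: primitive_root_expi.
have tM m : (expi t ^+ m == 1) = (d %| m)%N by rewrite (prim_order_dvd prim).
have tp : expi t ^+ p = 1 by apply/eqP; rewrite tM dvdn_gcdl.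
have tq : expi t ^+ q = 1 by apply/eqP; rewrite tM dvdn_gcdr.
have coNd : coprime d N.
  by rewrite /coprime /d gcdnC gcdnA hNp gcd1n.
(* [d] divides [N * m] and is coprime to [N]. This bounds the order from below and, for [m = 1],
   shows that the rotation is not the identity. *)
have tN m : expi (t *+ N *+ m) = 1 -> (d %| m)%N.
  by rewrite -mulrnA expiMn => /eqP; rewrite tM Gauss_dvdr.
have tN1 : expi (t *+ N) <> 1.
  by rewrite -[t *+ N]mulr1n => /tN; rewrite dvdn1 gtn_eqF.
exists (mkcts (@continuous_rotatel R (t *+ N))); split.
  exact: rotate_homeomorphism.
split; first exact: rotate_orientation_preserving.
split.
  exists d => //; split => // [w|m /andP[m0 md] /(_ _) mid].
    rewrite iter_rotate -[RHS]rotate0; apply: set_val_inj.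
    rewrite !set_val_rotate /rotate_fun expi0 -mulrnA expiMn.
    by have /eqP -> : expi t ^+ (N * d) == 1 by rewrite tM dvdn_mull.
  (* An iterate is tested at (1, 0), whose first coordinate becomes the rotation factor. *)
  have e_in : (1, 0) \in sphere3 R.
    by apply/mem_set; rewrite /sphere3 /= normr1 normr0 !expr0n expr1n addr0.
  have := mid (exist (fun w => w \in sphere3 R) _ e_in).
  rewrite iter_rotate => /(congr1 (fun w => (set_val w).1)) me.
  have {me} : expi (t *+ N *+ m) * 1 = 1 by exact: me.
  by rewrite mulr1 => /tN; rewrite gtnNdvd.
split; last 1 first.
- apply/seteqP; split => // w [].
  rewrite -[fixed_set _]/(fixed_set (rotate (t *+ N))) fixed_rotate //.
  move=> /= w0 [z zD wz].
  move: w0; rewrite wz /phi /= => /eqP; rewrite expf_eq0 N0 => /eqP z0.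
  apply: (@phi0_notin_sphere3 R N p q a b delta) => //.
  by rewrite -z0 -wz; exact: set_valP.
- apply/seteqP; split=> [_ [w Kw <-]|w Kw]; first exact: rotate_knot.
  (* The preimage of [w] is its inverse rotation, again on the knot because the inverse of [expi t]
     is a root of the same orders. *)
  exists (rotate ((- t) *+ N) w).
    by apply: rotate_knot => //; rewrite expiN exprVn ?tp ?tq invr1.
  rewrite -[LHS]/(rotate (t *+ N) (rotate (- t *+ N) w)).
  by rewrite rotateD mulNrn subrr rotate0.
exact: fixed_rotate_circle.
Qed.
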